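(* For every digraph $D$ of order $n$, $\gamma_{iso}(D)\le n-\delta^-(D)$, and the bound is sharp.
   Context: Digraphs $D=(V,A)$ are finite, without loops or multiple arcs (pairs of opposite arcs allowed). $N^+(v)=\{w: vw\in A\}$, $N^-(v)=\{w: wv\in A\}$, $\delta^-(D)=\min_v |N^-(v)|$. $S\subseteq V$ is out-dominating if every $v\in V\setminus S$ has an in-neighbor in $S$. $S$ is an in-secure out-dominating set (ISODS) if $S$ is out-dominating and for every $v\in V\setminus S$ there is $u\in N^+(v)\cap S$ such that $(S\setminus\{u\})\cup\{v\}$ is out-dominating; $\gamma_{iso}(D)$ is the minimum size of an ISODS. Sharp means equality holds for some digraph (e.g. the directed $4$-cycle). *)

(* Defs.v *)
From mathcomp Require Import all_boot.

Set Implicit Arguments.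
Unset Strict Implicit.
Unset Printing Implicit Defensive.

(* A finite loopless digraph; encoding the arcs as a relation rules out
   multiple arcs, while pairs of opposite arcs are allowed. *)
Record digraph := Digraph {
  vertex :> finType;
  arc : rel vertex;
  arc_irrefl : irreflexive arc
}.

Section Domination.

Variable D : digraph.
Implicit Types (S : {set D}) (u v w : D).

Definition out_nbhd v : {set D} := [set w | arc v w].
Definition in_nbhd v : {set D} := [set w | arc w v].

(* The default value #|D| exceeds every in-degree, so it is only returned
   (as 0) when D has no vertex; see min_indegP. *)
Definition min_indeg : nat := \big[minn/#|D|]_(v : D) #|in_nbhd v|.

Definition out_dominating S : bool :=
  [forall v in ~: S, exists u in S, u \in in_nbhd v].

Definition isods S : bool :=
  out_dominating S &&
  [forall v in ~: S, exists u in out_nbhd v :&: S,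
     out_dominating (v |: (S :\ u))].

(* The whole vertex set is always an ISODS (isods_setT), so this arg min is
   the minimum; see gamma_isoP. *)
Definition gamma_iso : nat := #|[arg min_(S < [set: D] | isods S) #|S|]|.

Lemma isods_setT : isods [set: D].
Proof.
by apply/andP; split; apply/forall_inP => v; rewrite setCT inE.
Qed.

Lemma gamma_isoP :
  (exists2 S, isods S & #|S| = gamma_iso) /\
  (forall S, isods S -> gamma_iso <= #|S|).
Proof.
rewrite /gamma_iso; case: arg_minnP => [|S0 S0P S0min]; first exact: isods_setT.
by split=> //; exists S0.
Qed.

Lemma min_indeg_le v : min_indeg <= #|in_nbhd v|.
Proof.
rewrite /min_indeg; have := mem_index_enum v.
elim: (index_enum D) => //= w r IHr; rewrite inE big_cons geq_min.
by case/predU1P => [-> | /IHr ->]; rewrite ?leqnn ?orbT.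
Qed.

Lemma min_indegP :
  0 < #|D| ->
  (exists v, #|in_nbhd v| = min_indeg) /\
  (forall v, min_indeg <= #|in_nbhd v|).
Proof.
case/card_gt0P => v0 _; split; last exact: min_indeg_le.
case: (@arg_minnP D v0 xpredT (fun v => #|in_nbhd v|)) => // v _ vmin.
exists v; apply/eqP; rewrite eqn_leq min_indeg_le andbT.
rewrite /min_indeg; elim/big_ind: _ => [|x y vx vy|w _].
- exact: max_card.
- by rewrite leq_min vx.
- exact: vmin.
Qed.

End Domination.

(* ordS is the cyclic successor of 'I_4. *)
Definition dicycle4_arc : rel 'I_4 := fun i j => j == ordS i.

Lemma dicycle4_arc_irrefl : irreflexive dicycle4_arc.
Proof. by case=> [[|[|[|[|]]]]]. Qed.

Definition dicycle4 : digraph := Digraph dicycle4_arc_irrefl.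

(* Main.v *)
Require Import Defs.
From mathcomp Require Import all_boot.

(** A set whose complement has at most delta^- vertices is out-dominating, since
    a vertex of the complement has at most delta^- - 1 in-neighbors there.  For
    the bound, let v have minimum in-degree and S be the complement of N^-(v).
    Every vertex outside S has v as an out-neighbor in S, and swapping it with v
    preserves the size of the set, hence out-domination.

    In the directed 4-cycle let S be an ISODS and v a vertex outside S.  Its
    predecessor is in S, and so is its only out-neighbor v+1; as v+2 is no
    longer dominated when v replaces v+1, it is in S too.  So S misses at most
    one vertex. *)

Lemma out_dominating_card_compl (D : digraph) (S : {set D}) :
  #|~: S| <= min_indeg D -> out_dominating S.
Proof.
move=> leS; apply/forall_inP => v vS; apply/exists_inP.
have: ~~ (in_nbhd v \subset ~: S :\ v).
  apply/negP => /subset_leq_card; apply/negP; rewrite -ltnNge.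
  apply: leq_trans (leq_trans leS (min_indeg_le v)).
  by rewrite (cardsD1 v (~: S)) vS.
case/subsetPn => u uv; rewrite !inE negb_and !negbK => /orP[/eqP uv_eq|uS].
  by move: uv; rewrite uv_eq inE arc_irrefl.
by exists u.
Qed.

Lemma isods_compl_in_nbhd (D : digraph) (v : D) :
  #|in_nbhd v| = min_indeg D -> isods (~: in_nbhd v).
Proof.
move=> vmin; apply/andP; split.
  by apply: out_dominating_card_compl; rewrite setCK vmin.
apply/forall_inP => w; rewrite setCK => wv; apply/exists_inP; exists v.
  by move: wv; rewrite !inE arc_irrefl andbT.
apply: out_dominating_card_compl; rewrite -vmin.
(* The swapped set misses only [v] and the vertices of N^-(v) other than [w]. *)
rewrite setCU setCD setCK setIC setIUl.
apply: leq_trans (leq_card_setU _ _) _.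
rewrite -!setDE [leqRHS](cardsD1 w) wv addnC leq_add2r.
by apply: leq_trans (subset_leq_card (subsetDl _ _)) _; rewrite cards1.
Qed.

Lemma gamma_iso_le (D : digraph) : gamma_iso D <= #|D| - min_indeg D.
Proof.
(* An empty digraph has no vertex of minimum in-degree. *)
have [D0|D_gt0] := posnP #|D|.
  have := (gamma_isoP D).2 _ (isods_setT D).
  by rewrite cardsT D0 sub0n.
have [[v vmin] _] := min_indegP D_gt0.
rewrite -vmin -(cardsC (in_nbhd v)) addKn.
exact: (gamma_isoP D).2 _ (isods_compl_in_nbhd _ _ vmin).
Qed.

(** This makes n - delta^- at most 3, the lower bound for an ISODS of the 4-cycle. *)
Lemma min_indeg_dicycle4_gt0 : 0 < min_indeg dicycle4.
Proof.
have [|[v <-] _] := @min_indegP dicycle4; first by rewrite card_ord.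
apply/card_gt0P; exists (ord_pred v : dicycle4).
by rewrite inE /= /dicycle4_arc ord_predK.
Qed.

Lemma isods_dicycle4_card (S : {set dicycle4}) : isods S -> 3 <= #|S|.
Proof.
case/andP => /forall_inP domS /forall_inP secS.
have succS (v : 'I_4) : v \notin S -> ordS v \in S.
  rewrite -in_setC => /secS /exists_inP[u].
  by rewrite !inE /= /dicycle4_arc => /andP[/eqP ->].
have succ2S (v : 'I_4) : v \notin S -> ordS (ordS v) \in S.
  move=> vS; apply: contraT => v2S.
  have: v \in ~: S by rewrite inE.
  case/secS/exists_inP => u; rewrite !inE /= /dicycle4_arc => /andP[/eqP -> _].
  move/forall_inP/(_ (ordS (ordS v))); rewrite !inE (negPf v2S) andbF orbF.
  have [-> v1] : ordS (ordS v) != v /\ ordS v != v.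
    by case: v {vS v2S} => [[|[|[|[|]]]]].
  (* The in-neighbor must be v+1, but the swap removed v+1 and added v. *)
  case/(_ isT)/exists_inP => w.
  rewrite !inE /= /dicycle4_arc => wS /eqP/(can_inj (@ordSK _)) w_eq.
  by move: wS; rewrite -w_eq eqxx (negPf v1).
have compl_le1 : #|~: S| <= 1.
  apply/card_le1_eqP => v w; rewrite !inE => vS wS; apply/eqP.
  (* The last case is w = v+3, written as v = w+1. *)
  have : [|| v == w, w == ordS v, w == ordS (ordS v) | v == ordS w].
    by case: v w {vS wS} => [[|[|[|[|]]]]] // ? [[|[|[|[|]]]]].
  case/or4P => /eqP eq_vw; first by rewrite eq_vw.
  - by move: wS; rewrite eq_vw succS.
  - by move: wS; rewrite eq_vw succ2S.
  - by move: vS; rewrite eq_vw succS.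
by rewrite -(leq_add2r #|~: S|) cardsC card_ord (leq_add2l 3 _ 1).
Qed.

Lemma gamma_iso_dicycle4 :
  gamma_iso dicycle4 = #|dicycle4| - min_indeg dicycle4.
Proof.
apply/eqP; rewrite eqn_leq gamma_iso_le /=.
have [[S /isods_dicycle4_card S3 <-] _] := gamma_isoP dicycle4.
by apply: leq_trans S3; rewrite card_ord (leq_sub2l 4 min_indeg_dicycle4_gt0).
Qed.

Theorem theorem5p3 :
  (forall (n : nat) (D : digraph), #|D| = n ->
     gamma_iso D <= n - min_indeg D) /\
  (exists D : digraph, gamma_iso D = #|D| - min_indeg D) /\
  gamma_iso dicycle4 = #|dicycle4| - min_indeg dicycle4.
Proof.
split; first by move=> n D <-; exact: gamma_iso_le.
split; last exact: gamma_iso_dicycle4.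
by exists dicycle4; exact: gamma_iso_dicycle4.
Qed.
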